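(* (1) If $(\alpha^*,u^* )$ is an inverse Stackelberg solution, then with $u_0^*=\alpha^*[u^*]$ the pair $(u_0^*,u^* )$ belongs to $\mathcal{B}$ and maximizes $J_0$ over $\mathcal{B}$. (2) If $(u_0^*,u^* )\in\mathcal{B}$ maximizes $J_0$ over $\mathcal{B}$, then there exists an incentive strategy $\alpha^*$ with $\alpha^*[u^*]=u_0^*$ such that $(\alpha^*,u^* )$ is an inverse Stackelberg solution. (3) Suppose in addition that each $P_i$, $i=1,\dots,n$, is a nonempty convex compact subset of a Euclidean space and that for every $i=1,\dots,n$, every $u_0\in P_0$ and every $u_{-i}$, the function $u_i'\mapsto J_i(u_0,u_i',u_{-i})$ is quasiconcave on $P_i$. Then there exists at least one inverse Stackelberg solution.
   Context: Static game with a leader (player $0$) and followers $1,\dots,n$. Each $P_i$ ($i=0,\dots,n$) is a nonempty compact metric space and each payoff $J_i:P_0\times P_1\times\dots\times P_n\to\mathbb{R}$ ($i=0,\dots,n$) is continuous; each player maximizes. Let $P=P_1\times\dots\times P_n$; elements $u=(u_1,\dots,u_n)\in P$ are profiles of followers' strategies, and for $u_i'\in P_i$, $(u_i',u_{-i})$ denotes $u$ with the $i$-th component replaced by $u_i'$. Write $J_i(u_0,u)=J_i(u_0,u_1,\dots,u_n)$. An incentive strategy of the leader is an arbitrary map $\alpha:P\to P_0$. The set of followers' Nash equilibria against $\alpha$ is $\mathcal{E}(\alpha)=\{u\in P: J_i(\alpha[u],u)\ge J_i(\alpha[(u_i',u_{-i})],(u_i',u_{-i}))\ \text{for all } i=1,\dots,n,\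 u_i'\in P_i\}$. A pair $(\alpha^*,u^* )$ is an inverse Stackelberg solution if $u^*\in\mathcal{E}(\alpha^* )$ and $J_0(\alpha^*[u^*],u^* )=\sup_{\alpha}\sup_{u\in\mathcal{E}(\alpha)}J_0(\alpha[u],u)$ (supremum over all incentive strategies, $\sup\emptyset=-\infty$). Define $\mathcal{B}=\{(u_0,u)\in P_0\times P: J_i(u_0,u)\ge\max_{u_i'\in P_i}\min_{u_0'\in P_0}J_i(u_0',u_i',u_{-i})\ \text{for } i=1,\dots,n\}$. *)

(* Defs.v *)
From Stdlib Require Import Reals Lra Lia Arith List Classical.
From Stdlib Require Import Peano_dec Compare_dec.
Open Scope R_scope.

(* Index set {0,...,n-1}: follower i (1-based in the paper) is index i-1. *)
Definition I (n : nat) : Type := { i : nat | (i < n)%nat }.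

Lemma I_eq_dec (n : nat) (i j : I n) : {i = j} + {i <> j}.
Proof.
  destruct i as [i hi], j as [j hj].
  destruct (Nat.eq_dec i j) as [e|ne].
  - left. subst j. f_equal. apply le_unique.
  - right. intros H. inversion H. contradiction.
Defined.

Definition upd {n : nat} {X : I n -> Type} (u : forall j, X j) (i : I n) (x : X i)
  : forall j, X j :=
  fun j => match I_eq_dec n i j with
           | left e => eq_rect i X x j e
           | right _ => u j
           end.

Definition is_metric {X : Type} (d : X -> X -> R) : Prop :=
  (forall x y, 0 <= d x y) /\
  (forall x y, d x y = 0 <-> x = y) /\
  (forall x y, d x y = d y x) /\
  (forall x y z, d x z <= d x y + d y z).

Definition is_open {X : Type} (d : X -> X -> R) (U : X -> Prop) : Prop :=
  forall x, U x -> exists r, 0 < r /\ forall y, d x y < r -> U y.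

Definition is_compact {X : Type} (d : X -> X -> R) (S : X -> Prop) : Prop :=
  forall (Idx : Type) (U : Idx -> X -> Prop),
    (forall k, is_open d (U k)) ->
    (forall x, S x -> exists k, U k x) ->
    exists l : list Idx, forall x, S x -> exists k, In k l /\ U k x.

Definition nonempty {X : Type} (S : X -> Prop) : Prop := exists x, S x.

Section Game.
Variable n : nat.
Variable X0 : Type.
Variable d0 : X0 -> X0 -> R.
Variable X : I n -> Type.
Variable d : forall i, X i -> X i -> R.
Variable P0 : X0 -> Prop.
Variable P : forall i, X i -> Prop.

Definition inP (u : forall i, X i) : Prop := forall i, P i (u i).

(* continuity of f on P0 x P_1 x ... x P_n (product metric = max metric) *)
Definition cont_on (f : X0 -> (forall i, X i) -> R) : Prop :=
  forall x0 u, P0 x0 -> inP u ->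
  forall eps, 0 < eps -> exists delta, 0 < delta /\
    forall y0 v, P0 y0 -> inP v -> d0 x0 y0 < delta ->
      (forall i, d i (u i) (v i) < delta) -> Rabs (f y0 v - f x0 u) < eps.

Definition game_hyps (J0 : X0 -> (forall i, X i) -> R)
  (J : I n -> X0 -> (forall i, X i) -> R) : Prop :=
  nonempty P0 /\ is_compact d0 P0 /\
  (forall i, nonempty (P i) /\ is_compact (d i) (P i)) /\
  cont_on J0 /\ (forall i, cont_on (J i)).

Variable J0 : X0 -> (forall i, X i) -> R.
Variable J : I n -> X0 -> (forall i, X i) -> R.

(* incentive strategy: a map alpha : P -> P0 (values outside P are irrelevant) *)
Definition incentive (alpha : (forall i, X i) -> X0) : Prop :=
  forall u, inP u -> P0 (alpha u).

Definition in_E (alpha : (forall i, X i) -> X0) (u : forall i, X i) : Prop :=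
  inP u /\
  forall i (x : X i), P i x ->
    J i (alpha (upd u i x)) (upd u i x) <= J i (alpha u) u.

(* (alpha', u') is an inverse Stackelberg solution: u' in E(alpha') and
   J0(alpha'[u'],u') equals the sup over all incentive strategies alpha and all
   u in E(alpha); since the value is attained, this means it is an upper bound. *)
Definition inv_stackelberg (alpha' : (forall i, X i) -> X0) (u' : forall i, X i) : Prop :=
  in_E alpha' u' /\
  forall alpha u, incentive alpha -> in_E alpha u -> J0 (alpha u) u <= J0 (alpha' u') u'.

Definition is_min_of {T : Type} (A : T -> Prop) (f : T -> R) (v : R) : Prop :=
  (exists t, A t /\ f t = v) /\ (forall t, A t -> v <= f t).

Definition is_maxmin (i : I n) (u : forall j, X j) (v : R) : Prop :=
  (exists x, P i x /\ is_min_of P0 (fun y0 => J i y0 (upd u i x)) v) /\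
  (forall x, P i x -> forall w, is_min_of P0 (fun y0 => J i y0 (upd u i x)) w -> w <= v).

Definition in_B (x0 : X0) (u : forall i, X i) : Prop :=
  P0 x0 /\ inP u /\
  forall i, exists v, is_maxmin i u v /\ v <= J i x0 u.

Definition max_on_B (x0' : X0) (u' : forall i, X i) : Prop :=
  in_B x0' u' /\ forall x0 u, in_B x0 u -> J0 x0 u <= J0 x0' u'.

End Game.

Definition Rn (m : nat) : Type := I m -> R.

Definition coordR (m : nat) (x : Rn m) (k : nat) : R :=
  match lt_dec k m with
  | left h => x (exist _ k h)
  | right _ => 0
  end.

(* Euclidean distance sqrt(sum_{k<m} (x_k - y_k)^2) (term k = m is 0) *)
Definition euclid (m : nat) (x y : Rn m) : R :=
  sqrt (sum_f_R0 (fun k => (coordR m x k - coordR m y k) ^ 2) m).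

Definition comb {m : nat} (t : R) (x y : Rn m) : Rn m :=
  fun k => t * x k + (1 - t) * y k.

Definition convex {m : nat} (C : Rn m -> Prop) : Prop :=
  forall x y t, C x -> C y -> 0 <= t <= 1 -> C (comb t x y).

Definition quasiconcave_on {m : nat} (C : Rn m -> Prop) (f : Rn m -> R) : Prop :=
  forall x y t, C x -> C y -> 0 <= t <= 1 -> Rmin (f x) (f y) <= f (comb t x y).

(* Main.v *)
(* The pair [(u0, u)] is in [B] iff the leader can enforce it: play [u0] at [u], and
   after a deviation to [u'] of follower [i], who is then identified, play a minimizer
   of [J i (., u')].  So the pairs [(alpha u, u)] with [u] in [E alpha] are exactly
   the points of [B], which gives (1) and (2).

   For (3), [B] is closed in a compact set, and it contains [(u0, u)] for every [u0]
   as soon as [u] is a Nash equilibrium of the game with payoffs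
   [g i u = min_u0 J i u0 u], which are continuous and quasiconcave in the strategy
   of player [i].  By compactness, finitely many profiles [v_0, ..., v_K] contain
   an [e]-best reply to each profile.  Colour the grid point [p / N] of the simplex
   by some [k] for which [v_k] is an [e]-best reply to [sum_k (p k / N) v_k].  Scarf's
   lemma gives a point [s / N] such that each colour [k] with [s k <> 0] occurs near
   it; in the limit, [x = sum_k (s k / N) v_k] is an [e]-best reply to itself.  Let
   [e] tend to [0].  Limits are taken along ultrafilters instead of subsequences. *)
From Stdlib Require Import Reals Lra.
From mathcomp Require Import boolp classical_sets filter.
From mathcomp Require Import all_boot.
From mathcomp Require Import zify.
Require Import Defs.
Set Implicit Arguments. Unset Strict Implicit. Unset Printing Implicit Defensive.
Open Scope R_scope.

(** * Scarf's lemma for finitely many linear orders, by a parity argument *)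

Section Scarf.
Local Open Scope nat_scope.
Variables (T L : finType) (rk : L -> T -> nat) (t0 : T) (c : T -> L) (i0 : L).
Hypothesis rk_inj : forall i, injective (rk i).

(* [T + L] adds to the points a slack vertex for each order: the least element of
   its own order and, in the other orders, above all points.  A dominant set
   [inl @: sigma :|: inr @: ~: C] encodes Scarf's dominant pair [(sigma, C)]: no
   point lies above [sigma] in all the orders indexed by [C]. *)
Let bound := (\max_i \max_t rk i t).+2.

Definition slack_rank (i : L) (v : T + L) : nat :=
  match v with
  | inl t => (rk i t).+1
  | inr j => if j == i then 0 else bound + enum_rank j
  end.
Local Notation r := slack_rank.

Definition slack_colour (v : T + L) : L :=
  match v with inl t => c t | inr j => j end.
Local Notation col := slack_colour.

Let rk_bound i t : (rk i t).+1 < bound.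
Proof.
rewrite /bound !ltnS.
apply: leq_trans (leq_bigmax (F := fun i => \max_t rk i t) i).
exact: (leq_bigmax (F := rk i) t).
Qed.

Let slack_min i : r i (inr i) = 0.
Proof. by rewrite /= eqxx. Qed.

Let slack_top i j t : j != i -> r i (inl t) < r i (inr j).
Proof. by move=> /negbTE /= ->; apply: (leq_trans (rk_bound i t)); apply: leq_addr. Qed.

Let r_inj i : injective (r i).
Proof.
move=> [t|j] [t'|j'] /=.
- by move=> [] /rk_inj ->.
- by case: eqP => // _ e; have := rk_bound i t; rewrite e; lia.
- by case: eqP => // _ e; have := rk_bound i t'; rewrite -e; lia.
- case: eqP => [->|_]; case: eqP => [->|_] //; rewrite /bound; try lia.
  by move=> /addnI /val_inj /enum_rank_inj ->.
Qed.

Definition dominant (s : {set T + L}) :=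
  [forall y, exists i, forall x in s, r i y <= r i x].

(** Rooms play the part of the full-dimensional simplices of a triangulation; doors, below, are the
    candidate facets with all colours except [i0]. *)
Definition room s := dominant s && (#|s| == #|L|).

Let dominantP (s : {set T + L}) :
  reflect (forall y, exists i, forall x, x \in s -> r i y <= r i x) (dominant s).
Proof.
apply: (iffP forallP) => H y; have := H y.
- by case/existsP=> i /forall_inP h; exists i.
- by case=> i h; apply/existsP; exists i; apply/forall_inP.
Qed.

Let dominant_sub (s d : {set T + L}) : d \subset s -> dominant s -> dominant d.
Proof.
move=> ds /dominantP H; apply/dominantP => y; have [i h] := H y.
by exists i => x /(subsetP ds); apply: h.
Qed.

(** Dominance applied to an element of [s] itself makes that element the minimum of [s] in some
    order, so the minima [m i] exhaust [s]. *)
Lemma dominant_min (s : {set T + L}) v : dominant s -> v \in s ->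
  exists m : L -> T + L, [/\ forall i, m i \in s,
    forall i x, x \in s -> r i (m i) <= r i x & m @: setT = s].
Proof.
move=> /dominantP dom vs.
pose m i := [arg min_(x < v in s) r i x].
have mP i : m i \in s /\ forall x, x \in s -> r i (m i) <= r i x.
  by rewrite /m; case: arg_minnP.
exists m; split=> [i|i x|]; try by case: (mP i) => // _; apply.
apply/setP=> x; apply/imsetP/idP => [[i _ ->]|xs]; first by case: (mP i).
have [i h] := dom x; exists i => //; apply: (@r_inj i).
by apply/eqP; rewrite eqn_leq h ?(mP i).1 ?(mP i).2.
Qed.

Definition door (d : {set T + L}) := (#|d|.+1 == #|L|) && (col @: d == [set~ i0]).

Let sub_door (d s : {set T + L}) : #|d|.+1 = #|s| -> d \subset s ->
  exists2 y, y \notin d & s = y |: d.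
Proof.
move=> cd ds; have : #|s :\: d| == 1.
  by rewrite cardsD (setIidPr ds) -cd subSnn.
case/cards1P=> y hy; exists y.
  by have := set11 y; rewrite -hy inE => /andP[].
by rewrite -[LHS](setID _ d) (setIidPr ds) hy setUC.
Qed.

(** If the room has a door at all, its one further vertex [y] repeats the colour of a vertex [z] of
    that door; the doors are then exactly [s] without [y] and [s] without [z]. *)
Lemma even_doors (s : {set T + L}) : room s -> col @: s != setT ->
  ~~ odd #|[set d | door d & d \subset s]|.
Proof.
case/andP=> _ /eqP cs ncol.
have [->|[d0]] := set_0Vmem [set d | door d & d \subset s]; first by rewrite cards0.
rewrite inE => /andP[/andP[/eqP cd /eqP cold] ds].
have inj : {in d0 &, injective col}.
  apply/imset_injP; rewrite cold cardsC1; by rewrite -cd.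
have [y yd def_s] := sub_door (etrans cd (esym cs)) ds.
have cy : col y != i0.
  apply: contra ncol => /eqP cy; rewrite def_s imsetU1 cold cy.
  by apply/eqP/setP=> i; rewrite !inE orbN.
have : col y \in col @: d0 by rewrite cold !inE.
case/imsetP=> z zd cyz.
have yz : y != z by apply: contra yd => /eqP ->.
suff -> : [set d | door d & d \subset s] = [set s :\ y; s :\ z].
  rewrite cards2; have -> //: s :\ y != s :\ z.
  apply/eqP=> /setP/(_ y); rewrite !inE eqxx yz def_s !inE eqxx //.
have sy : s :\ y = d0 by rewrite def_s setU1K.
have zs : z \in s by rewrite def_s inE zd orbT.
have cso : col @: s = [set~ i0].
  by rewrite def_s imsetU1 cold; apply/setUidPr; rewrite sub1set !inE.
apply/setP=> d; rewrite !inE; apply/andP/orP.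
(* The vertex [w] missing from a door shares its colour with some [w'] of that door. As colours are
   distinct on [d0], [w] and [w'] are [y] and [z] in some order. *)
- case=> /andP[/eqP cd' /eqP cold'] dss.
  have [w wd def_s'] := sub_door (etrans cd' (esym cs)) dss.
  have dE : d = s :\ w by rewrite def_s' setU1K.
  have ws : w \in s by rewrite def_s' !inE eqxx.
  have : col w \in col @: d by rewrite cold' -cso imset_f.
  case/imsetP=> w' w'd cw.
  have w's : w' \in s by rewrite def_s' inE w'd orbT.
  have ww' : w != w' by apply: contra wd => /eqP ->.
  rewrite {}dE; move: ws w's; rewrite {1 2}def_s !inE.
  case/predU1P=> [->|wd0]; first by left.
  case/predU1P=> [w'y|w'd0].
    by right; rewrite (inj w z) // cw w'y.
  by rewrite (inj w w') ?eqxx // in ww'.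
- case=> /eqP ->.
    by rewrite sy ds /door cd cold !eqxx.
  rewrite subD1set; split=> //; rewrite /door.
  have := cardsD1 z s; rewrite zs cs add1n => <-; rewrite eqxx /= -cso eqEsubset.
  rewrite imsetS ?subD1set //=; apply/subsetP=> i /imsetP[w ws ->].
  have [->|wz] := eqVneq w z; last by apply: imset_f; rewrite !inE wz.
  by rewrite -cyz; apply: imset_f; rewrite !inE yz def_s !inE eqxx.
Qed.

(** * Rooms above a door that contains a point *)

Section InnerDoor.
Variables (d : {set T + L}) (t : T) (m : L -> T + L).
Hypotheses (cd : #|d|.+1 = #|L|) (td : inl t \in d) (domd : dominant d).
Hypotheses (m_in : forall i, m i \in d)
  (m_min : forall i x, x \in d -> r i (m i) <= r i x) (m_onto : m @: setT = d).

(** The vertices that can join [d] without displacing its minimum in any order other than [a]. *)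
Let Y a := [set y | [forall k, (k != a) ==> (r k (m k) < r k y)]].
Let YP a y : reflect (forall k, k != a -> r k (m k) < r k y) (y \in Y a).
Proof.
rewrite inE; apply: (iffP forallP) => H k; first by move=> ka; have := H k; rewrite ka.
by apply/implyP; apply: H.
Qed.

Let top a := [arg max_(y > (inr a : T + L) in Y a) r a y].

(** The default [inr a] of the maximum lies in [Y a]: in the orders other than [a] it is above the
    point [inl t] of [d], hence above the minimum of [d]. *)
Let topP a : top a \in Y a /\ forall y, y \in Y a -> r a y <= r a (top a).
Proof.
rewrite /top; case: arg_maxnP => //; apply/YP=> k ka.
by apply: leq_ltn_trans (m_min k td) _; apply: slack_top; rewrite eq_sym.
Qed.

Let Y_disj a b y : a != b -> y \in Y a -> y \in Y b -> False.
Proof.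
move=> ab /YP ya /YP yb; have [k hk] := dominantP _ domd y.
have := hk _ (m_in k); rewrite leqNgt; case: (eqVneq k a) => [e|/ya -> //].
by rewrite yb // e.
Qed.

Let top_notin a b : a != b -> m a = m b -> top a \notin d.
Proof.
move=> ab mab; apply/negP; have [/YP ya _] := topP a.
rewrite -{1}m_onto => /imsetP[k _ e].
have [ka|ka] := eqVneq k a; last by have := ya k ka; rewrite e ltnn.
by have := ya b; rewrite eq_sym ab e ka mab ltnn; move=> /(_ isT).
Qed.

(** A vertex [z] of [Y a] is below [top a] in order [a], and [top a] is below all of [d] there,
    since dominance of [d] leaves no other order for it. A vertex outside [Y a] is below some [m k]
    with [k] different from [a], and [m k] is still the minimum. *)
Let top_room a b : a != b -> m a = m b -> room (top a |: d).
Proof.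
move=> ab mab; rewrite /room cardsU1 (top_notin ab mab) add1n cd eqxx andbT.
have [/YP ya ymax] := topP a.
apply/dominantP=> z; have [zY|] := boolP (z \in Y a).
  exists a => x /setU1P[->|xd]; first exact: ymax.
  apply: leq_trans (ymax _ zY) _.
  have [i hi] := dominantP _ domd (top a).
  have [ia|/ya] := eqVneq i a; first by rewrite ia in hi; apply: hi.
  by rewrite ltnNge hi.
rewrite inE negb_forall => /existsP[k]; rewrite negb_imply -leqNgt => /andP[ka hz].
exists k => x /setU1P[->|xd]; first by apply: leq_trans hz _; apply/ltnW/ya.
exact: leq_trans hz (m_min k xd).
Qed.

(** The minima of a room are pairwise distinct, so [y] is the minimum in a single order [k] and the
    other minima are those of [d]. Dominance forces [y = top k], and the coincidence [m a = m b]
    must be broken, so [k] is [a] or [b]. *)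
Let room_top a b y : a != b -> m a = m b -> y \notin d -> room (y |: d) ->
  y = top a \/ y = top b.
Proof.
move=> ab mab yd /andP[dom cy].
have [m' [m'_in m'_min m'_onto]] := dominant_min dom (setU11 y d).
have m'_inj : injective m'.
  move=> i j; suff: {in setT &, injective m'} by move=> h; apply: h; rewrite inE.
  by apply/imset_injP; rewrite m'_onto (eqP cy) cardsT.
have : y \in m' @: setT by rewrite m'_onto setU11.
case/imsetP=> k _ yk.
have m'E k' : k' != k -> m' k' = m k'.
  move=> kk; have : m' k' \in d.
    by have := m'_in k'; rewrite in_setU1 => /predU1P[e|//]; case/eqP: kk; apply: m'_inj; rewrite e.
  move=> m'd; apply: (@r_inj k'); apply/eqP.
  by rewrite eqn_leq m_min // m'_min // in_setU1 m_in orbT.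
have yY : y \in Y k.
  apply/YP=> k' kk; rewrite ltn_neqAle -m'E // m'_min ?setU11 // andbT.
  by apply: contra yd => /eqP/(@r_inj k') <-; rewrite m'E.
have yE : y = top k.
  have [tY ymax] := topP k; apply: (@r_inj k); apply/eqP; rewrite eqn_leq ymax //=.
  have [i hi] := dominantP _ dom (top k).
  have [ik|ik] := eqVneq i k; first by rewrite ik in hi; apply: hi; rewrite setU11.
  have := hi (m i); rewrite in_setU1 m_in orbT => /(_ isT); rewrite leqNgt.
  by move/YP: tY => ->.
have [ka|ka] := eqVneq k a; first by left; rewrite yE ka.
have [kb|kb] := eqVneq k b; first by right; rewrite yE kb.
by case/eqP: ab; apply: m'_inj; rewrite !m'E // eq_sym.
Qed.

(** There is one order more than elements of [d], so two orders [a] and [b] share their minimum; the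
    two rooms add [top a] and [top b], which differ because [Y a] and [Y b] are disjoint. *)
Lemma inner_door_rooms : #|[set s | room s & d \subset s]| = 2.
Proof.
have : ~~ injectiveb m.
  apply/injectiveP => inj; have := card_imset setT inj; rewrite m_onto cardsT -cd => /esym/eqP.
  by rewrite eqn_leq ltnn.
move=> /fintype.injectivePn[a [b ab mab]].
have ba : b != a by rewrite eq_sym.
suff -> : [set s | room s & d \subset s] = [set top a |: d; top b |: d].
  rewrite cards2; have -> // : top a |: d != top b |: d.
  apply/eqP=> /setP/(_ (top a)); rewrite setU11 in_setU1 (negbTE (top_notin ab mab)) orbF.
  move=> /esym/eqP e; apply: (@Y_disj a b (top a)) => //; first by case: (topP a).
  by rewrite e; case: (topP b).
apply/setP=> s; rewrite !inE; apply/andP/orP.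
- case=> rs ds; have /andP[_ /eqP cs] := rs.
  have [y yd def_s] := sub_door (etrans cd (esym cs)) ds.
  by rewrite def_s in rs *; case: (room_top ab mab yd rs) => ->; [left | right].
- by case=> /eqP ->; rewrite subsetU1; split=> //; [apply: (top_room ab) | apply: (top_room ba)].
Qed.

End InnerDoor.

(** * The outer door and the parity count *)

Let outer : {set T + L} := [set inr j | j in [set~ i0]].

(** The only admissible new vertex is the largest point in order [i0]: in every other order the
    slack vertex has rank [0], below all points. Adding [inr i0] fails, as the point [t0] would be
    above all slack vertices in their own orders. *)
Lemma outer_door_rooms : #|[set s | room s & outer \subset s]| = 1.
Proof.
pose tm := [arg max_(t > t0) rk i0 t].
have tmP t : rk i0 t <= rk i0 tm by rewrite /tm; case: arg_maxnP => // x _; apply.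
have co : #|outer|.+1 = #|L|.
  rewrite card_imset; last by move=> ? ? [].
  by rewrite cardsC1 prednK //; apply/card_gt0P; exists i0.
have tmo : inl tm \notin outer by apply/imsetP=> [[]].
apply/eqP/cards1P; exists (inl tm |: outer); apply/setP=> s; rewrite !inE.
apply/andP/eqP.
- case=> /andP[/dominantP dom /eqP cs] os.
  have [y yo def_s] := sub_door (etrans co (esym cs)) os.
  have ino i : i != i0 -> inr i \in s by move=> ii; rewrite (subsetP os) // imset_f // !inE.
  case: y => [t|j] in yo def_s.
    rewrite def_s; congr (inl _ |: _).
    have [i hi] := dom (inl tm); have [ii|ii] := eqVneq i i0.
      subst i; apply: (rk_inj (i := i0)); apply/eqP; rewrite eqn_leq tmP /=.
      by have := hi (inl t); rewrite def_s setU11 => /(_ isT).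
    by have := hi _ (ino _ ii); rewrite slack_min.
  have ji : j = i0.
    by apply/eqP; apply: contraR yo => ji; rewrite imset_f // !inE.
  have [i hi] := dom (inl t0); have : inr i \in s.
    by have [->|/ino//] := eqVneq i i0; rewrite def_s ji setU11.
  by move/hi; rewrite slack_min.
- move=> ->; rewrite subsetU1 /room cardsU1 tmo add1n co eqxx andbT; split=> //.
  apply/dominantP=> -[t|j]; last by exists j => x _; rewrite slack_min.
  exists i0 => x /setU1P[->|]; first exact: tmP.
  by case/imsetP=> j; rewrite !inE => ji ->; apply/ltnW/slack_top.
Qed.

Let door_outer (d : {set T + L}) : door d -> (forall t, inl t \notin d) -> d = outer.
Proof.
case/andP=> _ /eqP cold nt; apply/setP=> -[t|j].
  by rewrite (negbTE (nt t)); apply/esym/imsetP => [[]].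
have -> : (inr j \in outer) = (j \in [set~ i0]).
  by apply/imsetP/idP => [[k kk [->]]//|jj]; exists j.
rewrite -cold; apply/idP/imsetP => [jd|]; first by exists (inr j).
by case=> -[t|k] //; [rewrite (negbTE (nt t)) | move=> kd /= ->].
Qed.

Lemma odd_rooms (d : {set T + L}) : door d -> odd #|[set s | room s & d \subset s]| = (d == outer).
Proof.
move=> dd; have [->|d_outer] := eqVneq d outer; first by rewrite outer_door_rooms.
have [->|[s]] := set_0Vmem [set s | room s & d \subset s]; first by rewrite cards0.
rewrite inE => /andP[/andP[doms _] ds].
have domd := dominant_sub ds doms.
have [t td] : exists t, inl t \in d.
  apply/existsP; apply: contraR d_outer; rewrite negb_exists => /forallP h.
  by apply/eqP/door_outer.
have [m [m1 m2 m3]] := dominant_min domd td.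
by rewrite (inner_door_rooms _ td domd m1 m2 m3) //; apply/eqP; case/andP: dd.
Qed.

(* Parity: count the pairs of a door and a room above it in two ways. *)
Lemma colourful_room : exists2 s : {set T + L}, room s & col @: s = setT.
Proof.
suff /existsP[s /andP[rs /eqP cs]] : [exists s, room s && (col @: s == setT)] by exists s.
apply: contraT; rewrite negb_exists => /forallP none.
have swap : \sum_(s | room s) #|[set d | door d & d \subset s]| =
            \sum_(d | door d) #|[set s | room s & d \subset s]|.
  under eq_bigr do rewrite -sum1_card.
  under [RHS]eq_bigr do rewrite -sum1_card.
  rewrite (exchange_big_dep door) /= => [|s d _]; last by rewrite inE => /andP[].
  apply: eq_bigr => d dd; apply: eq_bigl => s; by rewrite !inE dd.
have odd_sum (J : finType) (P : pred J) (F : J -> nat) :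
    odd (\sum_(j | P j) F j) = odd (\sum_(j | P j) odd (F j)).
  by apply: (big_ind2 (fun x y => odd x = odd y)) => [//|x y z w|j _];
    rewrite ?oddD ?oddb // => -> ->.
(* Without a colourful room every room has evenly many doors, whereas the outer door is the only one
   with an odd number of rooms above it. *)
have := congr1 odd swap; rewrite odd_sum big1 /= => [|s rs]; last first.
  apply/eqP; rewrite eqb0; apply: even_doors => //.
  by have := none s; rewrite rs.
rewrite odd_sum (eq_bigr (fun d => nat_of_bool (d == outer))); last by move=> d /odd_rooms ->.
have door_o : door outer.
  rewrite /door card_imset; last by move=> ? ? [].
  rewrite cardsC1 prednK ?eqxx /=; last by apply/card_gt0P; exists i0.
  rewrite -imset_comp; apply/eqP/setP=> i; apply/imsetP/idP => [[j jj ->]//|ii].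
  by exists i.
by rewrite (bigD1 outer) //= eqxx big1 // => d /andP[_ /negbTE ->].
Qed.
End Scarf.

(** * Scarf's lemma on the grid of the simplex *)

Section Grid.
Local Open Scope nat_scope.
Variables (K N : nat).
Local Notation L := 'I_K.+1.

Definition grid := {f : {ffun L -> 'I_N.+1} | \sum_i f i == N}.

Definition coord (t : grid) (i : L) : nat := val t i.

Lemma sum_coord t : \sum_i coord t i = N.
Proof. exact: eqP (valP t). Qed.

Lemma grid_of (q : L -> nat) : \sum_i q i = N -> exists t, coord t =1 q.
Proof.
move=> sq; have qN i : q i < N.+1 by rewrite ltnS -sq (bigD1 i) //= leq_addr.
pose f : {ffun L -> 'I_N.+1} := [ffun i => Ordinal (qN i)].
have h : \sum_i f i == N.
  by apply/eqP; rewrite -[RHS]sq; apply: eq_bigr => i _; rewrite ffunE.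
by exists (Sub f h) => i; rewrite /coord SubK ffunE.
Qed.

(** Order by the [i]-th coordinate, ties being broken by the enumeration of the grid so that the
    rank is injective. *)
Definition coord_rank (i : L) (t : grid) := coord t i * #|{: grid}| + enum_rank t.

Lemma coord_rank_inj i : injective (coord_rank i).
Proof.
move=> t u /(congr1 (modn^~ #|{: grid}|)); rewrite !modnMDl !modn_small //.
by move/val_inj/enum_rank_inj.
Qed.

Lemma coord_rank_le i t u : coord_rank i t <= coord_rank i u -> coord t i <= coord u i.
Proof.
apply: contraTT; rewrite -!ltnNge => ut; rewrite /coord_rank.
apply: (@leq_trans (coord t i * #|{: grid}|)); last exact: leq_addr.
apply: (@leq_trans ((coord u i).+1 * #|{: grid}|)); last by rewrite leq_mul2r ut orbT.
by rewrite mulSn addnC ltn_add2r.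
Qed.

(* The minima [q i], for [i] in [C], of the coordinates over a dominant cell
   cannot all be increased by one inside the simplex, so they sum up to almost [N]. *)
Lemma sum_min_gt (C : {set L}) (q : L -> nat) (i1 : L) :
  (forall t, exists2 i, i \in C & coord t i <= q i) ->
  N < \sum_(i in C) q i + #|C|.
Proof.
move=> dom; rewrite ltnNge -sum1_card -big_split /=; apply/negP=> le.
(* Otherwise this grid point, with the leftover mass put on [i1], exceeds [q] at every index of
   [C]. *)
pose y i := (if i \in C then q i + 1 else 0) +
  (if i == i1 then N - \sum_(i in C) (q i + 1) else 0).
have [|t ty] := grid_of (q := y).
  by rewrite big_split /= -big_mkcond /= -big_mkcond /= big_pred1_eq subnKC.
have [i iC] := dom t; rewrite ty /y iC; lia.
Qed.

(** Let [C] index the slack vertices absent from a colourful room: every colour in [C] is then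
    carried by a point of the room. The minima over [C] sum up to at least [N - K], so all points of
    the room lie within [K] of them. *)
Lemma colourful_point (c : grid -> L) (t0 : grid) : exists s : L -> nat,
  \sum_i s i = N /\
  forall i, s i != 0 -> exists2 t, c t = i &
    forall j, coord t j <= s j + K /\ s j <= coord t j + K.
Proof.
have [s /andP[/forallP dom _] cs] := colourful_room t0 c ord0 coord_rank_inj.
pose C := [set i | inr i \notin s].
have col_C i : i \in C -> exists2 t, inl t \in s & c t = i.
  rewrite inE => iC; have : i \in slack_colour c @: s by rewrite cs inE.
  by case/imsetP=> -[t|j] js /= e; [exists t | rewrite e js in iC].
have dom_C t : exists2 i, i \in C & forall u, inl u \in s -> coord t i <= coord u i.
  have /existsP[i /forall_inP hi] := dom (inl t).
  exists i; first by rewrite inE; apply/negP=> /hi; rewrite /= eqxx.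
  by move=> u /hi /=; rewrite ltnS => /coord_rank_le.
have [i1 i1C _] := dom_C t0; have [u1 u1s _] := col_C _ i1C.
pose q i := coord [arg min_(t < u1 | inl t \in s) coord t i] i.
have q_min i t : inl t \in s -> q i <= coord t i.
  by rewrite /q; case: arg_minnP => // u _; apply.
have q_ex i : exists2 u, inl u \in s & coord u i = q i.
  by rewrite /q; case: arg_minnP => // u us _; exists u.
have q_gt : N < \sum_(i in C) q i + #|C|.
  apply: (sum_min_gt i1) => t; have [i iC hi] := dom_C t; exists i => //.
  by have [u us <-] := q_ex i; apply: hi.
have C_le : #|C| <= K.+1 by have := max_card C; rewrite card_ord.
pose b i := if i \in C then q i else 0.
have bE : \sum_i b i = \sum_(i in C) q i by rewrite [RHS]big_mkcond.
have b_le t i : inl t \in s -> b i <= coord t i.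
  by rewrite /b; case: ifP => // _; apply: q_min.
have b_sum : \sum_i b i <= N.
  by rewrite -(sum_coord u1); apply: leq_sum => i _; apply: b_le.
(* The missing mass, at most [K], goes to [i1], which belongs to [C], so that the support stays
   inside [C]. *)
exists (fun i => b i + if i == i1 then N - \sum_i b i else 0); split.
  by rewrite big_split /= -[X in _ + X]big_mkcond big_pred1_eq subnKC.
move=> i i_nz; have iC : i \in C.
  have [-> //|ii1] := eqVneq i i1.
  by move: i_nz; rewrite /b (negbTE ii1) addn0; case: ifP.
have [t ts ct] := col_C _ iC; exists t => // j.
have tj : coord t j + \sum_i b i <= N + b j.
  rewrite -(sum_coord t) (bigD1 j) //= [X in _ <= X + _](bigD1 j) //=.
  rewrite -addnA leq_add2l [b j + _]addnC leq_add2r.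
  by apply: leq_sum => k _; apply: b_le.
have := b_le t j ts; case: ifP => _; lia.
Qed.

Lemma grid_labelling (c : (nat -> nat) -> nat) :
  (forall p : nat -> nat, \sum_(k < K.+1) p k = N -> c p <= K) ->
  exists s : nat -> nat, \sum_(k < K.+1) s k = N /\
    forall k, k <= K -> s k <> 0 -> exists p : nat -> nat,
      [/\ \sum_(k < K.+1) p k = N, c p = k &
        forall j, j <= K -> p j <= s j + K /\ s j <= p j + K].
Proof.
move=> c_le; pose ext (f : 'I_K.+1 -> nat) k := f (inord k).
have ext_sum f : \sum_(k < K.+1) ext f k = \sum_k f k.
  by apply: eq_bigr => k _; rewrite /ext inord_val.
have [t0 _] : exists t : grid, coord t =1 fun k => if k == ord0 then N else 0.
  by apply: grid_of; rewrite -big_mkcond big_pred1_eq.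
have [s [s_sum hs]] := colourful_point (fun t => inord (c (ext (coord t)))) t0.
exists (ext s); split=> [|k kK sk]; first by rewrite ext_sum.
have [|t ct ht] := hs (inord k); first exact/eqP.
have t_sum : \sum_(k < K.+1) ext (coord t) k = N by rewrite ext_sum sum_coord.
exists (ext (coord t)); split=> // [|j _]; last exact: ht.
by have := congr1 val ct; rewrite /= !inordK // ltnS ?c_le.
Qed.

End Grid.

(** * Ultrafilters, limits in compact sets and attained maxima *)

Lemma fip_ultrafilter (T Idx : Type) (A : Idx -> T -> Prop) :
  (forall l, exists t, forall k, List.In k l -> A k t) ->
  exists F : set_system T, UltraFilter F /\ forall k, F (A k).
Proof.
move=> fip.
(* The sets containing a finite intersection of the [A k] form a proper filter, which extends to an
   ultrafilter. *)
pose G : set_system T := fun B => exists l, forall t, (forall k, List.In k l -> A k t) -> B t.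
have PG : ProperFilter G.
  split; first by case=> l h; have [t ht] := fip l; exact: h ht.
  split; first by exists nil.
  - move=> B C [l hl] [l' hl']; exists (l ++ l')%list => t ht.
    by split; [apply: hl | apply: hl'] => k hk; apply: ht; apply: List.in_or_app; [left|right].
  - by move=> B C BC [l hl]; exists l => t /hl /BC.
have [F [UF GF]] := ultraFilterLemma PG.
exists F; split=> // k; apply: GF; exists (k :: nil)%list => t; apply; exact: List.in_eq.
Qed.

Lemma free_ultrafilter : exists F : set_system nat,
  UltraFilter F /\ forall M : nat, F (fun N => (M <= N)%coq_nat).
Proof.
apply: fip_ultrafilter => l; exists (List.list_max l) => k hk.
by move: (proj1 (List.list_max_le l _) (le_n _)) => /List.Forall_forall/(_ _ hk).
Qed.

Section Ultralimit.
Variables (T : Type) (F : set_system T).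
Hypothesis UF : UltraFilter F.

Lemma ultra_contra (A : T -> Prop) : (F (fun t => ~ A t) -> False) -> F A.
Proof. by move=> h; case: (in_ultra_setVsetC A UF) => // /h. Qed.

Lemma filter_bounded_forall (A : nat -> T -> Prop) (K : nat) :
  (forall k, (k < K)%coq_nat -> F (A k)) ->
  F (fun t => forall k, (k < K)%coq_nat -> A k t).
Proof.
elim: K => [|K IH] h; first by apply: filterS (filterT); move=> t _ k; lia.
apply: filterS2 (IH _) (h K _); [|move=> k ?; apply: h; lia|lia].
move=> t h1 h2 k hk; have [->//|ne] := eqVneq k K; apply: h1.
by move/eqP: ne; lia.
Qed.

Lemma filter_I_forall (n : nat) (A : I n -> T -> Prop) :
  (forall i, F (A i)) -> F (fun t => forall i, A i t).
Proof.
move=> h; pose B k t := forall hk : (k < n)%coq_nat, A (exist _ k hk) t.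
apply: filterS (_ : F (fun t => forall k, (k < n)%coq_nat -> B k t)).
  by move=> t ht [k hk]; apply: ht.
apply: filter_bounded_forall => k hk; apply: filterS (h (exist _ k hk)) => t ht hk'.
by rewrite (Prop_irrelevance hk' hk).
Qed.

Variables (X : Type) (d : X -> X -> R).

Definition ultralim (s : T -> X) (x : X) :=
  forall e, 0 < e -> F (fun t => d x (s t) < e).

Hypothesis d_refl : forall x, d x x = 0.
Hypothesis d_triangle : forall x y z, d x z <= d x y + d y z.

(** If no point of [S] is a limit, each is the centre of a ball that [s] avoids on a set of [F].
    Finitely many avoided balls cover [S], and then [s] avoids [S] on a set of [F]. *)
Lemma compact_ultralim (S : X -> Prop) (s : T -> X) : is_compact d S ->
  F (fun t => S (s t)) -> exists x, S x /\ ultralim s x.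
Proof.
move=> cS Fs; apply: contrapT => none.
have far x : S x -> exists e, 0 < e /\ F (fun t => ~ d x (s t) < e).
  move=> Sx; apply: contrapT => h; apply: none; exists x; split=> // e e0.
  by apply: ultra_contra => h'; apply: h; exists e.
pose Idx := {p : X * R | F (fun t => ~ d p.1 (s t) < p.2)}.
have [||l hl] := cS Idx (fun k y => d (sval k).1 y < (sval k).2).
- move=> k x hx; exists ((sval k).2 - d (sval k).1 x); split=> [|y hy]; first lra.
  by have := d_triangle (sval k).1 x y; lra.
- move=> x Sx; have [e [e0 Fe]] := far x Sx.
  by exists (exist _ (x, e) Fe); rewrite /= d_refl.
have Fl : F (fun t => forall k, List.In k l -> ~ d (sval k).1 (s t) < (sval k).2).
  elim: l {hl} => [|k l IH]; first by apply: filterS filterT => t _ k [].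
  by apply: filterS2 IH (svalP k) => t h1 h2 k' [<-|/h1].
have [t [ht /hl[k [kl hk]]]] := filter_ex (filterI Fl Fs).
exact: ht hk.
Qed.

End Ultralimit.

(** The superlevel sets of [f] at its own values are nested, so some ultrafilter contains them all.
    The second hypothesis, upper semicontinuity along ultrafilters, gives a point of [S] at which
    [f] is at least each of these values. *)
Lemma attains_max (Z : Type) (S : Z -> Prop) (f : Z -> R) : (exists z, S z) ->
  (forall F : set_system Z, UltraFilter F -> F S ->
    exists z, S z /\ forall e, 0 < e -> F (fun w => f w < f z + e)) ->
  exists z, S z /\ forall w, S w -> f w <= f z.
Proof.
move=> [z0 Sz0] usc; apply: contrapT => none.
have higher z : S z -> exists w, S w /\ f z < f w.
  move=> Sz; apply: contrapT => h; apply: none; exists z; split=> // w Sw.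
  by apply: Rnot_lt_le => lt; apply: h; exists w.
have [l|F [UF FA]] := @fip_ultrafilter Z {z | S z} (fun z w => S w /\ f (sval z) <= f w).
  suff [w [Sw hw]] : exists w, S w /\ forall k, List.In k l -> f (sval k) <= f w by exists w; auto.
  elim: l => [|k l [w [Sw hw]]]; first by exists z0.
  have [le|lt] := Rle_lt_dec (f w) (f (sval k)).
    exists (sval k); split=> [|k' [<-|/hw]]; [exact: svalP|lra|lra].
  by exists w; split=> // k' [<-|/hw //]; lra.
have FS : F S by apply: filterS (FA (exist _ z0 Sz0)) => w [].
have [z [Sz hz]] := usc F UF FS; have [z' [Sz' lt]] := higher z Sz.
have gap : 0 < f z' - f z by lra.
have [w [h1 [_ h2]]] := filter_ex (filterI (hz _ gap) (FA (exist _ z' Sz'))).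
by rewrite /= in h2; lra.
Qed.

(** * Replacing one component of a profile *)

Section Update.
Variables (n : nat) (X : I n -> Type).
Implicit Types (u : forall j, X j).

Lemma upd_same u i x : upd u i x i = x.
Proof.
rewrite /upd; case: (I_eq_dec n i i) => // e.
by rewrite (Prop_irrelevance e erefl).
Qed.

Lemma upd_other u i x j : i <> j -> upd u i x j = u j.
Proof. by rewrite /upd; case: (I_eq_dec n i j). Qed.

Lemma upd_id u i : upd u i (u i) = u.
Proof.
apply: functional_extensionality_dep => j.
have [ij|ij] := I_eq_dec n i j; last exact: upd_other.
by subst j; apply: upd_same.
Qed.

Lemma inP_upd (P : forall i, X i -> Prop) u i x :
  inP n X P u -> P i x -> inP n X P (upd u i x).
Proof.
move=> Pu Px j; have [ij|ij] := I_eq_dec n i j; last by rewrite upd_other.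
by subst j; rewrite upd_same.
Qed.

End Update.

(** * Limits of profiles and approximate best replies *)

Section Profiles.
Variables (n : nat) (X : I n -> Type) (d : forall i, X i -> X i -> R).
Variable P : forall i, X i -> Prop.
Arguments d : clear implicits.
Arguments P : clear implicits.
Hypothesis d_refl : forall i x, d i x x = 0.
Hypothesis d_triangle : forall i x y z, d i x z <= d i x y + d i y z.
Hypothesis P_compact : forall i, is_compact (d i) (P i).
Local Notation profile := (forall i, X i).
Local Notation inP := (inP n X P).

Definition profile_lim T (F : set_system T) (s : T -> profile) (u : profile) :=
  forall i, ultralim F (d i) (fun t => s t i) (u i).

Definition ultra_continuous (f : profile -> R) :=
  forall T (F : set_system T) (s : T -> profile) u, UltraFilter F ->
    F (fun t => inP (s t)) -> inP u -> profile_lim F s u ->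
    forall e, 0 < e -> F (fun t => Rabs (f (s t) - f u) < e).

Lemma compact_profile_lim T (F : set_system T) (s : T -> profile) :
  UltraFilter F -> F (fun t => inP (s t)) -> exists u, inP u /\ profile_lim F s u.
Proof.
move=> UF Fs.
have lim i : exists x, P i x /\ ultralim F (d i) (fun t => s t i) x.
  apply: (compact_ultralim UF (@d_refl i) (@d_triangle i) (@P_compact i)).
  by apply: filterS Fs => t; apply.
exists (fun i => sval (cid (lim i))).
by split=> i; case: (svalP (cid (lim i))).
Qed.

Lemma profile_lim_upd T (F : set_system T) (s : T -> profile) u i (x : T -> X i) y :
  UltraFilter F -> profile_lim F s u -> ultralim F (d i) x y ->
  profile_lim F (fun t => upd (s t) i (x t)) (upd u i y).
Proof.
move=> UF su xy j e e0; have [ij|ij] := I_eq_dec n i j.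
  by subst j; apply: filterS (xy e e0) => t; rewrite !upd_same.
by apply: filterS (su j e e0) => t; rewrite !upd_other.
Qed.

Lemma ultralim_const T (F : set_system T) i (x : X i) :
  UltraFilter F -> ultralim F (d i) (fun=> x) x.
Proof. by move=> UF e e0; apply: filterS filterT => t _; rewrite d_refl. Qed.

Variable g : I n -> profile -> R.
Hypothesis P_nonempty : forall i, nonempty (P i).
Hypothesis g_continuous : forall i, ultra_continuous (g i).

(** Each [v i] is judged as a reply to [u] with only the component [i] changed, so an
    [e]-equilibrium is a [u] with [near_reply e u u]. *)
Definition near_reply (e : R) (u v : profile) :=
  inP v /\ forall i x, P i x -> g i (upd u i x) <= g i (upd u i (v i)) + e.

Lemma payoff_upd_lim T (F : set_system T) (s : T -> profile) u i (x : T -> X i) y :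
  UltraFilter F -> F (fun t => inP (s t)) -> inP u -> profile_lim F s u ->
  F (fun t => P i (x t)) -> P i y -> ultralim F (d i) x y ->
  forall e, 0 < e -> F (fun t => Rabs (g i (upd (s t) i (x t)) - g i (upd u i y)) < e).
Proof.
move=> UF Fs Pu su Fx Py xy; apply: g_continuous.
- by apply: filterS2 Fs Fx => t; apply: inP_upd.
- exact: inP_upd.
- exact: profile_lim_upd.
Qed.

Lemma best_reply u : inP u -> exists v, near_reply 0 u v.
Proof.
move=> Pu.
have best i : exists x, P i x /\ forall y, P i y -> g i (upd u i y) <= g i (upd u i x).
  apply: (attains_max (P_nonempty i)) => F UF FP.
  have [x [Px hx]] := compact_ultralim UF (@d_refl i) (@d_triangle i) (@P_compact i) FP.
  exists x; split=> // e e0.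
  have Fu : F (fun=> inP u) by apply: filterS filterT.
  apply: filterS (payoff_upd_lim UF Fu Pu _ FP Px hx e0); last first.
    by move=> i'; apply: ultralim_const.
  by move=> y /Rabs_def2; lra.
exists (fun i => sval (cid (best i))).
split=> [i|i x Px]; case: (svalP (cid (best i))) => // _ /(_ x Px).
by rewrite Rplus_0_r.
Qed.

(** The graph of the [e]-best reply relation is closed: a violation by [a] at the limit would
    survive two errors below [a / 2]. *)
Lemma near_reply_lim T (F : set_system T) (s w : T -> profile) u v e :
  UltraFilter F -> F (fun t => inP (s t)) -> inP u -> profile_lim F s u ->
  inP v -> profile_lim F w v -> F (fun t => near_reply e (s t) (w t)) -> near_reply e u v.
Proof.
move=> UF Fs Pu su Pv wv Fr; split=> // i x Px; apply: Rnot_lt_le => lt.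
pose a := g i (upd u i x) - (g i (upd u i (v i)) + e).
have a0 : 0 < a / 2 by rewrite /a; lra.
have Fx : F (fun=> P i x) by apply: filterS filterT.
have Fw : F (fun t => P i (w t i)) by apply: filterS Fr => t [+ _]; apply.
have h1 := payoff_upd_lim UF Fs Pu su Fx Px (ultralim_const _ UF) a0.
have h2 := payoff_upd_lim UF Fs Pu su Fw (Pv i) (wv i) a0.
have [t [[/Rabs_def2 h1t /Rabs_def2 h2t] [_ /(_ i x Px) rt]]] :=
  filter_ex (filterI (filterI h1 h2) Fr).
by move: h1t h2t; rewrite /a; lra.
Qed.

(** Otherwise some player has, on a set of [F], deviations gaining more than [e] over [v i]; their
    limit would still be a strict improvement on [v i] at [u]. *)
Lemma near_reply_nbhs T (F : set_system T) (s : T -> profile) u v e :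
  UltraFilter F -> F (fun t => inP (s t)) -> inP u -> profile_lim F s u ->
  near_reply 0 u v -> 0 < e -> F (fun t => near_reply e (s t) v).
Proof.
move=> UF Fs Pu su [Pv uv] e0.
suff Fi i : F (fun t => forall x, P i x -> g i (upd (s t) i x) <= g i (upd (s t) i (v i)) + e).
  by apply: filterS (filter_I_forall UF Fi) => t h; split.
apply: ultra_contra => // Fn.
have [x0 Px0] := P_nonempty i.
(* Choose a profitable deviation where there is one, and [x0] elsewhere. *)
have /choice[x hx] : forall t, exists x, P i x /\
    (~ (forall x, P i x -> g i (upd (s t) i x) <= g i (upd (s t) i (v i)) + e) ->
     g i (upd (s t) i (v i)) + e < g i (upd (s t) i x)).
  move=> t; apply: contrapT => none; apply: (none); exists x0; split=> // h; exfalso.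
  apply: h => x Px; apply: Rnot_lt_le => lt; apply: none; by exists x.
have Fx : F (fun t => P i (x t)) by apply: filterS filterT => t _; case: (hx t).
have [y [Py xy]] := compact_ultralim UF (@d_refl i) (@d_triangle i) (@P_compact i) Fx.
have Fv : F (fun=> P i (v i)) by apply: filterS filterT.
have e2 : 0 < e / 2 by lra.
have h1 := payoff_upd_lim UF Fs Pu su Fx Py xy e2.
have h2 := payoff_upd_lim UF Fs Pu su Fv (Pv i) (ultralim_const _ UF) e2.
have [t [[/Rabs_def2 h1t /Rabs_def2 h2t] nt]] := filter_ex (filterI (filterI h1 h2) Fn).
by have := proj2 (hx t) nt; have := uv i y Py; lra.
Qed.

(** If no finite list suffices, some ultrafilter contains, for each [v], the profiles to which [v]
    is not an [e]-best reply. It converges to some [u], and an exact best reply to [u] gives a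
    contradiction. *)
Lemma finite_near_replies e : 0 < e ->
  exists l, forall u, inP u -> exists v, List.In v l /\ near_reply e u v.
Proof.
move=> e0; apply: contrapT => none.
have [l|F [UF FA]] := @fip_ultrafilter profile profile
  (fun v u => inP u /\ ~ near_reply e u v).
  apply: contrapT => h; apply: none; exists l => u Pu; apply: contrapT => h'.
  apply: h; exists u => v lv; split=> // uv; apply: h'; by exists v.
pose u0 i := sval (cid (P_nonempty i)).
have FP : F (fun u => inP u) by apply: filterS (FA u0) => u [].
have [u [Pu Fu]] := compact_profile_lim UF FP.
have [v uv] := best_reply Pu.
have [w [h [_ //]]] := filter_ex (filterI (near_reply_nbhs UF FP Pu Fu uv e0) (FA v)).
Qed.

End Profiles.

(** * The Euclidean distance and convex combinations *)

Lemma sqrt_plane_triangle p q a b : 0 <= p -> 0 <= q ->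
  sqrt ((p + q) ^ 2 + (a + b) ^ 2) <= sqrt (p ^ 2 + a ^ 2) + sqrt (q ^ 2 + b ^ 2).
Proof.
move=> p0 q0; set A := p ^ 2 + a ^ 2; set B := q ^ 2 + b ^ 2.
have A0 : 0 <= A by rewrite /A; nra.
have B0 : 0 <= B by rewrite /B; nra.
have sA := sqrt_pos A; have sB := sqrt_pos B.
have CS : p * q + a * b <= sqrt A * sqrt B.
  rewrite -sqrt_mult //; have [neg|pos] := Rle_lt_dec (p * q + a * b) 0.
    by have := sqrt_pos (A * B); lra.
  rewrite -(sqrt_pow2 (p * q + a * b)); last lra.
  (* Lagrange's identity: [A * B - (p * q + a * b) ^ 2 = (p * b - a * q) ^ 2]. *)
  apply: sqrt_le_1_alt; rewrite /A /B; have := pow2_ge_0 (p * b - a * q); nra.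
rewrite -(sqrt_pow2 (sqrt A + sqrt B)); last lra.
apply: sqrt_le_1_alt; have := pow2_sqrt A A0; have := pow2_sqrt B B0; rewrite /A /B in CS *; nra.
Qed.

(** Induction on the number of coordinates: each step is the plane inequality with [p] and [q] the
    norms of the preceding coordinates. *)
Lemma sqrt_sum_triangle (f g : nat -> R) k :
  sqrt (sum_f_R0 (fun j => (f j + g j) ^ 2) k) <=
  sqrt (sum_f_R0 (fun j => f j ^ 2) k) + sqrt (sum_f_R0 (fun j => g j ^ 2) k).
Proof.
have sq0 (h : nat -> R) j : 0 <= sum_f_R0 (fun j => h j ^ 2) j.
  by apply: cond_pos_sum => i; apply: pow2_ge_0.
elim: k => [|k IH] /=.
  have := @sqrt_plane_triangle 0 0 (f 0%N) (g 0%N) (Rle_refl 0) (Rle_refl 0).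
  by rewrite /= !(Rplus_0_l, Rmult_0_l, Rplus_0_r).
have e (h : nat -> R) : sum_f_R0 (fun j => h j ^ 2) k = sqrt (sum_f_R0 (fun j => h j ^ 2) k) ^ 2.
  by rewrite pow2_sqrt.
have := @sqrt_plane_triangle _ _ (f k.+1) (g k.+1) (sqrt_pos (sum_f_R0 (fun j => f j ^ 2) k))
  (sqrt_pos (sum_f_R0 (fun j => g j ^ 2) k)).
rewrite -!e; apply: Rle_trans; apply: sqrt_le_1_alt; apply: Rplus_le_compat_r.
rewrite (e (fun j => f j + g j)); apply: pow_incr; split=> //; exact: sqrt_pos.
Qed.

Lemma euclid_triangle m x y z : euclid m x z <= euclid m x y + euclid m y z.
Proof.
apply: Rle_trans (sqrt_sum_triangle _ _ _); apply/Req_le; congr sqrt.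
by apply: PartSum.sum_eq => k _; congr (_ ^ 2); ring.
Qed.

Lemma euclid_refl m x : euclid m x x = 0.
Proof.
rewrite /euclid (PartSum.sum_eq _ (fun=> 0)) => [|k _]; last by ring.
by rewrite sum_cte Rmult_0_l sqrt_0.
Qed.

Lemma euclid_le_sum m x y :
  euclid m x y <= sum_f_R0 (fun k => Rabs (coordR m x k - coordR m y k)) m.
Proof.
rewrite /euclid; set f := fun k => coordR m x k - coordR m y k.
suff h j : 0 <= sum_f_R0 (fun k => Rabs (f k)) j /\
    sum_f_R0 (fun k => f k ^ 2) j <= sum_f_R0 (fun k => Rabs (f k)) j ^ 2.
  have [h1 h2] := h m; rewrite -[X in _ <= X]sqrt_pow2 //; exact: sqrt_le_1_alt.
elim: j => [|j [h1 h2]] /=.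
  by split; [exact: Rabs_pos|have := pow2_abs (f 0%N); rewrite /=; lra].
have := Rabs_pos (f j.+1); have := pow2_abs (f j.+1); rewrite /= in h2 *; split; first lra.
by nra.
Qed.

Definition lin_comb {m : nat} (w : nat -> R) (v : nat -> Rn m) (K : nat) : Rn m :=
  fun a => sum_f_R0 (fun k => w k * v k a) K.

(** By induction, a partial sum either has total weight [0] and vanishes, or lies in [C] after
    division by its weight. Membership is asked at nonzero weights because only such colours are
    known to give near replies. *)
Lemma convex_lin_comb m (C : Rn m -> Prop) w v K : convex C ->
  (forall k, (k <= K)%coq_nat -> 0 <= w k) ->
  (forall k, (k <= K)%coq_nat -> w k <> 0 -> C (v k)) ->
  sum_f_R0 w K = 1 -> C (lin_comb w v K).
Proof.
move=> cC w0 vC w1.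
suff [[z _]|[_]] : (sum_f_R0 w K = 0 /\ forall a, lin_comb w v K a = 0) \/
    (0 < sum_f_R0 w K /\ C (fun a => lin_comb w v K a / sum_f_R0 w K)).
- lra.
- by rewrite w1; congr C; apply: funext => a; apply: Rdiv_1_r.
elim: K w0 vC {w1} => [|K IH] w0 vC; rewrite /lin_comb /=.
  have [z|nz] := Req_dec (w 0%N) 0; [left|right].
    by split=> // a; rewrite z; ring.
  have w00 := w0 0%N (le_n _); split; first lra.
  have := vC 0%N (le_n _) nz; congr C; apply: funext => a; by field.
have wK := w0 K.+1 (le_n _).
have [z|nz] := Req_dec (w K.+1) 0.
  have [k kK|k kK|[S0 v0]|[S0 CS]] := IH; [apply: w0; lia|apply: vC; lia|left|right].
    by rewrite S0 z; split=> [|a]; [ring|have := v0 a; rewrite /lin_comb => ->; ring].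
  rewrite z; split; first lra.
  move: CS; congr C; apply: funext => a; rewrite /lin_comb; congr Rdiv; ring.
have CK := vC K.+1 (le_n _) nz; right.
have [k kK|k kK|[S0 v0]|[S0 CS]] := IH; [apply: w0; lia|apply: vC; lia| |].
  rewrite S0; split; first lra.
  move: CK; congr C; apply: funext => a; have := v0 a; rewrite /lin_comb => ->; by field.
split; first lra.
have tot : 0 < sum_f_R0 w K + w K.+1 by lra.
have t01 : 0 <= sum_f_R0 w K / (sum_f_R0 w K + w K.+1) <= 1.
  split; first by apply: Rle_mult_inv_pos => //; lra.
  apply: (Rmult_le_reg_r (sum_f_R0 w K + w K.+1)) => //.
  by rewrite /Rdiv Rmult_assoc Rinv_l; lra.
have := cC _ _ _ CS CK t01; congr C; apply: funext => a.
rewrite /comb /lin_comb; field; lra.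
Qed.

Lemma coordR_lin_comb m (w : nat -> R) (v : nat -> Rn m) K a :
  coordR m (lin_comb w v K) a = sum_f_R0 (fun k => w k * coordR m (v k) a) K.
Proof.
rewrite /coordR /lin_comb; case: Compare_dec.lt_dec => // _.
by rewrite (PartSum.sum_eq _ (fun=> 0)) => [|k _]; [rewrite sum_cte; ring|ring].
Qed.

Lemma euclid_lin_comb m (w w' : nat -> R) (v : nat -> Rn m) K e :
  (forall k, (k <= K)%coq_nat -> Rabs (w k - w' k) <= e) ->
  euclid m (lin_comb w v K) (lin_comb w' v K) <=
  e * sum_f_R0 (fun a => sum_f_R0 (fun k => Rabs (coordR m (v k) a)) K) m.
Proof.
move=> ww'; apply: Rle_trans (euclid_le_sum _ _) _.
rewrite scal_sum; apply: sum_Rle => a _; rewrite !coordR_lin_comb -minus_sum.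
apply: Rle_trans (Rsum_abs _ _) _; rewrite [X in _ <= X]Rmult_comm scal_sum.
apply: sum_Rle => k kK; rewrite -Rmult_minus_distr_r Rabs_mult Rmult_comm.
by apply: Rmult_le_compat_l (ww' k kK); apply: Rabs_pos.
Qed.

Lemma sum_INR (s : nat -> nat) K :
  sum_f_R0 (fun k => INR (s k)) K = INR (\sum_(k < K.+1) s k).
Proof.
elim: K => [|K IH]; first by rewrite big_ord_recr big_ord0.
by rewrite big_ord_recr /= -plusE plus_INR -IH.
Qed.

(** * Existence of a Nash equilibrium *)

Section Nash.
Variables (n : nat) (m : I n -> nat) (P : forall i, Rn (m i) -> Prop).
Arguments P : clear implicits.
Local Notation profile := (forall i, Rn (m i)).
Local Notation E i := (euclid (m i)).
Variable g : I n -> profile -> R.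
Hypothesis P_nonempty : forall i, nonempty (P i).
Hypothesis P_compact : forall i, is_compact (E i) (P i).
Hypothesis P_convex : forall i, convex (P i).
Hypothesis g_continuous : forall i, ultra_continuous (fun i => E i) P (g i).
Hypothesis g_quasiconcave : forall i u, inP n _ P u ->
  quasiconcave_on (P i) (fun x => g i (upd (X := fun j => Rn (m j)) u i x)).
Let profile_limit T (F : set_system T) := profile_lim (X := fun i => Rn (m i)) (fun i => E i) F.
Let reply := near_reply (X := fun i => Rn (m i)) P g.
Let P_profile : profile -> Prop := inP n (fun i => Rn (m i)) P.

(** The [e]-best replies of one player form a superlevel set of a quasiconcave function. *)
Lemma near_reply_convex e u i : P_profile u -> convex (fun z => P i z /\
  forall x, P i x -> g i (upd (X := fun j => Rn (m j)) u i x) <=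
                     g i (upd (X := fun j => Rn (m j)) u i z) + e).
Proof.
move=> Pu y z t [Py hy] [Pz hz] t01; split=> [|x Px]; first exact: P_convex.
have := g_quasiconcave Pu Py Pz t01; have := hy x Px; have := hz x Px.
by rewrite /Rmin; case: Rle_dec; lra.
Qed.

Lemma near_fixed_point e : 0 < e -> exists u, reply e u u.
Proof.
move=> e0; pose u0 : profile := fun i => sval (cid (P_nonempty i)).
have Pu0 : P_profile u0 by move=> i; exact: (svalP (cid (P_nonempty i))).
have Erefl i := @euclid_refl (m i); have Etri i := @euclid_triangle (m i).
have [l hl] := finite_near_replies Erefl Etri P_compact P_nonempty g_continuous e0.
pose K := (List.length l).-1.
(* Entries outside [P] are replaced by [u0], so that every [v k] may enter a convex combination. *)
pose v k : profile :=
  if pselect (P_profile (List.nth k l u0)) then List.nth k l u0 else u0.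
have v_in k : P_profile (v k) by rewrite /v; case: pselect.
have v_ex u : exists k, (k <= K)%N /\ (P_profile u -> reply e u (v k)).
  have [Pu|nPu] := pselect (P_profile u); last by exists 0%N.
  have [w [lw uw]] := hl u Pu; have [k [kl vk]] := List.In_nth l w u0 lw.
  by exists k; split; [rewrite /K; lia|rewrite /v vk; case: pselect => // nPw; case: nPw; case: uw].
(* The grid has mesh [1 / (N + 1)], which avoids division by zero. *)
pose pt N (p : nat -> nat) : profile :=
  fun i => lin_comb (fun k => INR (p k) / INR N.+1) (fun k => v k i) K.
have INR_pos N : 0 < INR N.+1 by apply: lt_0_INR; lia.
pose c N p := sval (cid (v_ex (pt N p))).
have hc N p : (c N p <= K)%N /\ (P_profile (pt N p) -> reply e (pt N p) (v (c N p))).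
  exact: svalP (cid (v_ex (pt N p))).
have weight_pos N (p : nat -> nat) k : 0 <= INR (p k) / INR N.+1.
  by apply: Rle_mult_inv_pos => //; apply: pos_INR.
have weight_sum N (p : nat -> nat) : \sum_(k < K.+1) p k = N.+1 ->
    sum_f_R0 (fun k => INR (p k) / INR N.+1) K = 1.
  move=> sp; rewrite -(Rinv_r (INR N.+1)); last by have := INR_pos N; lra.
  by rewrite -[X in INR X * _]sp -sum_INR Rmult_comm scal_sum.
have pt_in N (p : nat -> nat) : \sum_(k < K.+1) p k = N.+1 -> P_profile (pt N p).
  move=> sp i; apply: convex_lin_comb => // [k kK _|]; last exact: weight_sum.
  exact: v_in.
have [s hs] := choice (fun N => @grid_labelling K N.+1 (c N) (fun p _ => proj1 (hc N p))).
have [F [UF tails]] := free_ultrafilter.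
have Fs : F (fun N => P_profile (pt N (s N))).
  by apply: filterS filterT => N _; apply: pt_in; case: (hs N).
have [x [Px sx]] := compact_profile_lim Erefl Etri P_compact UF Fs.
have lim_const i (z : Rn (m i)) : ultralim F (E i) (fun=> z) z.
  by move=> d d0; apply: filterS filterT => t _; rewrite euclid_refl.
(* Grid points within [K] units of [s N] have the same limit [x], as their weights differ by at most
   [K / (N + 1)]. *)
have pt_lim (p : nat -> nat -> nat) :
    F (fun N => forall j, (j <= K)%N -> (p N j <= s N j + K)%N /\ (s N j <= p N j + K)%N) ->
    profile_limit F (fun N => pt N (p N)) x.
  move=> Fp i d d0.
  pose B := sum_f_R0 (fun a => sum_f_R0 (fun k => Rabs (coordR (m i) (v k i) a)) K) (m i).
  have B0 : 0 <= B by apply: cond_pos_sum => a; apply: cond_pos_sum => k; apply: Rabs_pos.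
  have d2 : 0 < d / 2 by lra.
  have [M hM] := INR_unbounded (INR K * B / (d / 2)).
  apply: filterS3 (sx i _ d2) Fp (tails M) => N h1 h2 MN.
  apply: Rle_lt_trans (Etri i _ (pt N (s N) i) _) _.
  suff : E i (pt N (s N) i) (pt N (p N) i) <= INR K / INR N.+1 * B.
    have : INR K / INR N.+1 * B < d / 2; last lra.
    have MN' : INR M <= INR N.+1 by apply: le_INR; lia.
    apply: (Rmult_lt_reg_r (INR N.+1)) => //.
    have -> : INR K / INR N.+1 * B * INR N.+1 = INR K * B by field; have := INR_pos N; lra.
    have -> : INR K * B = INR K * B / (d / 2) * (d / 2) by field; lra.
    rewrite [X in _ < X]Rmult_comm; apply: Rmult_lt_compat_r; lra.
  apply: euclid_lin_comb => k kK; have [|l1 l2] := h2 k; first lia.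
  rewrite -Rdiv_minus_distr /Rdiv Rabs_mult.
  have inv_pos : 0 < / INR N.+1 by apply: Rinv_0_lt_compat.
  rewrite (Rabs_pos_eq (/ _)); last exact: Rlt_le.
  apply: Rmult_le_compat_r; first exact: Rlt_le.
  have : INR (p N k) <= INR (s N k) + INR K by rewrite -plus_INR; apply: le_INR; lia.
  have : INR (s N k) <= INR (p N k) + INR K by rewrite -plus_INR; apply: le_INR; lia.
  by move=> ? ?; apply: Rabs_le; lra.
(* Either [s N k] vanishes on a set of [F], or on such a set there are points of colour [k] near
   [s N]. In the second case these converge to [x], and closedness makes [v k] an [e]-best reply to
   [x]. *)
have reply_x k : (k <= K)%N -> F (fun N => s N k <> 0%N -> reply e x (v k)).
  move=> kK; have [Fz|Fnz] := in_ultra_setVsetC (fun N => s N k = 0%N) UF.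
    by apply: filterS Fz => N z nz; case: nz.
  have /choice[p hp] : forall N, exists p : nat -> nat, s N k <> 0%N ->
      [/\ \sum_(k < K.+1) p k = N.+1, c N p = k &
        forall j, (j <= K)%N -> (p j <= s N j + K)%N /\ (s N j <= p j + K)%N].
    move=> N; have [z|nz] := pselect (s N k = 0%N); first by exists (s N).
    by have [p hp] := proj2 (hs N) k kK nz; exists p.
  apply: filterS filterT => _ _ _.
  apply: (near_reply_lim Erefl g_continuous UF (s := fun N => pt N (p N)) (w := fun=> v k)) => //.
  - by apply: filterS Fnz => N /hp[pN _ _]; apply: pt_in.
  - by apply: pt_lim; apply: filterS Fnz => N /hp[].
  - exact: v_in.
  - by apply: filterS Fnz => N /hp[pN <- _]; apply: (proj2 (hc N _)); apply: pt_in.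
exists x.
(* By convexity [pt N (s N)] is an [e]-best reply to the fixed profile [x], to which it
   converges. *)
apply: (near_reply_lim Erefl g_continuous UF (s := fun=> x) (w := fun N => pt N (s N))) => //.
- by apply: filterS filterT.
have : F (fun N => forall k, (k < K.+1)%coq_nat -> s N k <> 0%N -> reply e x (v k)).
  by apply: filter_bounded_forall => k kK; apply: reply_x; lia.
apply: filterS => N hN; split; first by apply: pt_in; case: (hs N).
move=> i; have [k _|k kK nz||_] := convex_lin_comb (near_reply_convex (e := e) (i := i) Px)
  (w := fun k => INR (s N k) / INR N.+1) (v := fun k => v k i) (K := K).
- exact: weight_pos.
- have [||Pv hv] := hN k; [lia| |].
    by move=> z; apply: nz; rewrite z /=; apply: Rdiv_0_l.
  by split=> [|x' Px']; [apply: Pv|apply: hv].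
- by apply: weight_sum; case: (hs N).
- exact.
Qed.

(** The sets of [e]-equilibria are nonempty and shrink with [e], so one ultrafilter contains them
    all; its limit is an [e]-equilibrium for every [e]. *)
Lemma nash_equilibrium : exists u, P_profile u /\
  forall i x, P i x -> g i (upd (X := fun j => Rn (m j)) u i x) <= g i u.
Proof.
have Erefl i := @euclid_refl (m i); have Etri i := @euclid_triangle (m i).
have mono e e' u : e <= e' -> reply e u u -> reply e' u u.
  by move=> ee' [Pu h]; split=> // i x Px; have := h i x Px; lra.
have [l|F [UF FA]] := @fip_ultrafilter profile {e | 0 < e} (fun e u => reply (sval e) u u).
  have [e [e0 he]] : exists e, 0 < e /\ forall k, List.In k l -> e <= sval k.
    elim: l => [|k l [e [e0 he]]]; first by exists 1; split; [lra|].
    exists (Rmin e (sval k)); split; first exact: Rmin_pos e0 (svalP k).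
    move=> k' [<-|/he h]; [exact: Rmin_r|exact: Rle_trans (Rmin_l _ _) h].
  have [u hu] := near_fixed_point e0.
  by exists u => k /he le; apply: mono le hu.
have FP : F P_profile by apply: filterS (FA (exist _ 1 Rlt_0_1)) => u [].
have [u [Pu su]] := compact_profile_lim Erefl Etri P_compact UF FP.
exists u; split=> // i x Px; apply: le_epsilon => e e0.
have [_ /(_ i x Px)] := near_reply_lim Erefl g_continuous UF FP Pu su Pu su (FA (exist _ e e0)).
by rewrite upd_id.
Qed.

End Nash.

(** * Security levels, the set [B] and the leader's problem *)

Section Leader.
Variables (n : nat) (X0 : Type) (d0 : X0 -> X0 -> R).
Variables (X : I n -> Type) (d : forall i, X i -> X i -> R).
Variables (P0 : X0 -> Prop) (P : forall i, X i -> Prop).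
Arguments d : clear implicits.
Arguments P : clear implicits.
Local Notation profile := (forall i, X i).
Local Notation inP := (inP n X P).
Variable J0 : X0 -> profile -> R.
Variable J : I n -> X0 -> profile -> R.
Hypothesis d0_refl : forall x, d0 x x = 0.
Hypothesis d0_triangle : forall x y z, d0 x z <= d0 x y + d0 y z.
Hypothesis d_refl : forall i x, d i x x = 0.
Hypothesis d_triangle : forall i x y z, d i x z <= d i x y + d i y z.
Hypothesis hyps : game_hyps n X0 d0 X d P0 P J0 J.

Lemma cont_on_lim f T (F : set_system T) (y : T -> X0) (s : T -> profile) y0 u :
  cont_on n X0 d0 X d P0 P f -> UltraFilter F ->
  F (fun t => P0 (y t)) -> F (fun t => inP (s t)) -> P0 y0 -> inP u ->
  ultralim F d0 y y0 -> profile_lim d F s u ->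
  forall e, 0 < e -> F (fun t => Rabs (f (y t) (s t) - f y0 u) < e).
Proof.
move=> cf UF Fy Fs Py Pu yy su e e0.
have [r [r0 hr]] := cf y0 u Py Pu e e0.
apply: filterS3 (filterI Fy Fs) (yy r r0) (filter_I_forall UF (fun i => su i r r0)) => t [? ?] ? ?.
exact: hr.
Qed.

Lemma leader_min f u : cont_on n X0 d0 X d P0 P f -> inP u ->
  exists y, P0 y /\ forall y', P0 y' -> f y u <= f y' u.
Proof.
move=> cf Pu; have [ne [P0_compact _]] := hyps.
have [|y [Py hy]] := @attains_max X0 P0 (fun y => - f y u) ne.
- move=> F UF FP.
  have [y [Py yy]] := compact_ultralim UF d0_refl d0_triangle P0_compact FP.
  exists y; split=> // e e0.
  have Fu : F (fun=> inP u) by apply: filterS filterT.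
  have uu : profile_lim d F (fun=> u) u by move=> i; apply: ultralim_const.
  by apply: filterS (cont_on_lim cf UF FP Fu Py Pu yy uu e0) => t /Rabs_def2; lra.
- by exists y; split=> // y' /hy; lra.
Qed.

Lemma security_ex : exists g : I n -> profile -> R, forall i u, inP u ->
  is_min_of P0 (fun y => J i y u) (g i u).
Proof.
have [_ [_ [_ [_ J_cont]]]] := hyps.
have ex i u : exists r, inP u -> is_min_of P0 (fun y => J i y u) r.
  have [Pu|nPu] := pselect (inP u); last by exists 0.
  have [y [Py hy]] := leader_min (J_cont i) Pu.
  by exists (J i y u) => _; split=> //; exists y.
by exists (fun i u => sval (cid (ex i u))) => i u; apply: svalP (cid (ex i u)).
Qed.

Variable g : I n -> profile -> R.
Hypothesis g_min : forall i u, inP u -> is_min_of P0 (fun y => J i y u) (g i u).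

(** The lower bound comes from a limit [y'] of minimizers at [s t], the upper bound from keeping a
    minimizer [y1] at [u] fixed. *)
Lemma security_continuous i : ultra_continuous d P (g i).
Proof.
move=> T F s u UF Fs Pu su e e0.
have [[y0 Py0] [P0_compact [_ [_ J_cont]]]] := hyps.
have /choice[y hy] : forall t, exists y, P0 y /\ (inP (s t) -> J i y (s t) = g i (s t)).
  move=> t; have [Pt|nPt] := pselect (inP (s t)); last by exists y0.
  by have [[y [Py hy]] _] := g_min i Pt; exists y.
have Fy : F (fun t => P0 (y t)) by apply: filterS filterT => t _; case: (hy t).
have [y' [Py' yy']] := compact_ultralim UF d0_refl d0_triangle P0_compact Fy.
have [[y1 [Py1 hy1]] gu] := g_min i Pu.
have Fy1 : F (fun=> P0 y1) by apply: filterS filterT.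
have y11 : ultralim F d0 (fun=> y1) y1.
  by move=> r r0; apply: filterS filterT => t _; rewrite d0_refl.
have h1 := cont_on_lim (J_cont i) UF Fy Fs Py' Pu yy' su e0.
have h2 := cont_on_lim (J_cont i) UF Fy1 Fs Py1 Pu y11 su e0.
apply: filterS3 Fs h1 h2 => t Pt /Rabs_def2 h1t /Rabs_def2 h2t.
have [_ /(_ y1 Py1) gt] := g_min i Pt.
have := gu y' Py'; have := proj2 (hy t) Pt.
by move=> et ?; apply: Rabs_def1; lra.
Qed.

(** This trades the maxmin value for one inequality per deviation; conversely the maximum over
    deviations is attained, at a best reply for the payoffs [g]. *)
Lemma in_B_iff y u : in_B n X0 X P0 P J y u <->
  P0 y /\ inP u /\ forall i x, P i x -> g i (upd u i x) <= J i y u.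
Proof.
have [_ [_ [hP _]]] := hyps.
split=> -[Py [Pu h]]; split=> //; split=> // i.
  move=> x Px; have [v [[_ vmax] vJ]] := h i.
  by apply: Rle_trans _ vJ; apply: (vmax x Px); apply: g_min; apply: inP_upd.
have [v [Pv hv]] := best_reply d_refl d_triangle (fun i => proj2 (hP i))
  (fun i => proj1 (hP i)) security_continuous Pu.
exists (g i (upd u i (v i))); split; last exact: h.
split=> [|x Px w [[y' [Py' <-]] wmin]].
  by exists (v i); split=> //; apply: g_min; apply: inP_upd.
have := hv i x Px; rewrite Rplus_0_r; apply: Rle_trans.
by have [[y'' [Py'' <-]] _] := g_min i (inP_upd Pu Px); apply: wmin.
Qed.

(* The leader plays [y] at [u] and punishes the unique deviator everywhere else. *)
Lemma enforce y u : in_B n X0 X P0 P J y u ->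
  exists alpha, incentive n X0 X P0 P alpha /\ alpha u = y /\ in_E n X0 X P J alpha u.
Proof.
move=> /in_B_iff[Py [Pu hB]].
have /choice[alpha h] : forall v, exists z, P0 z /\ (v = u -> z = y) /\
    (v <> u -> forall i x, P i x -> v = upd u i x -> J i z v = g i v).
  move=> v; have [->|vu] := pselect (v = u); first by exists y.
  have [[i [x [Px vE]]]|none] := pselect (exists i x, P i x /\ v = upd u i x); last first.
    by exists y; split=> //; split=> // _ i x Px vE; case: none; exists i, x.
  have Pv : inP v by rewrite vE; apply: inP_upd.
  have [[z [Pz hz]] _] := g_min i Pv; exists z; split=> //; split=> // _ j x' Px' vE'.
  have [ij|ij] := I_eq_dec n i j; first by subst j.
  (* Were [v] also a deviation of some [j] other than [i], its component [i] would be [u i], and [v]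
     would equal [u]. *)
  case: vu; rewrite vE -{2}(upd_id u i); congr upd.
  by rewrite -(upd_same u x) -vE vE' upd_other // => ji; apply: ij.
exists alpha; split; first by move=> v _; case: (h v).
have au : alpha u = y by apply: (proj1 (proj2 (h u))).
split=> //; split=> // i x Px; rewrite au.
have [e|ne] := pselect (upd u i x = u); first by rewrite e au; apply: Rle_refl.
by rewrite (proj2 (proj2 (h _)) ne i x) //; apply: hB.
Qed.

(** Whatever [alpha] answers to a deviation leaves the deviator at least the security level
    [g i]. *)
Lemma equilibrium_in_B alpha u : incentive n X0 X P0 P alpha ->
  in_E n X0 X P J alpha u -> in_B n X0 X P0 P J (alpha u) u.
Proof.
move=> Pa [Pu hE]; apply/in_B_iff; split; first exact: Pa.
split=> // i x Px; apply: Rle_trans _ (hE i x Px).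
by have [_] := g_min i (inP_upd Pu Px); apply; apply: Pa; apply: inP_upd.
Qed.

Lemma solution_max_on_B alpha u : incentive n X0 X P0 P alpha ->
  inv_stackelberg n X0 X P0 P J0 J alpha u ->
  max_on_B n X0 X P0 P J0 J (alpha u) u.
Proof.
move=> Pa [hE opt]; split; first exact: equilibrium_in_B.
move=> y v /enforce[beta [Pb [<- hb]]]; exact: opt.
Qed.

Lemma max_on_B_solution y u : max_on_B n X0 X P0 P J0 J y u ->
  exists alpha, incentive n X0 X P0 P alpha /\ alpha u = y /\
    inv_stackelberg n X0 X P0 P J0 J alpha u.
Proof.
move=> [/enforce[alpha [Pa [au hE]]] opt]; exists alpha; split=> //; split=> //.
split=> // beta v Pb hb; rewrite au; apply: opt; exact: equilibrium_in_B.
Qed.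

(** The inequalities of [in_B_iff] pass to limits, so every ultrafilter on [B] converges in [B], and
    [J0] is continuous. *)
Lemma max_on_B_ex : (exists y u, in_B n X0 X P0 P J y u) ->
  exists y u, max_on_B n X0 X P0 P J0 J y u.
Proof.
move=> [y0 [u0 hB0]]; have [_ [P0_compact [hP [J0_cont J_cont]]]] := hyps.
have [||[y u] [hB opt]] := @attains_max (X0 * profile)
  (fun z => in_B n X0 X P0 P J z.1 z.2) (fun z => J0 z.1 z.2).
- by exists (y0, u0).
- move=> F UF FB.
  have Fy : F (fun z => P0 z.1) by apply: filterS FB => z [].
  have Fu : F (fun z => inP z.2) by apply: filterS FB => z [_ []].
  have [y [Py yl]] := compact_ultralim UF d0_refl d0_triangle P0_compact Fy.
  have [u [Pu ul]] := compact_profile_lim d_refl d_triangle (fun i => proj2 (hP i)) UF Fu.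
  exists (y, u); split=> [|e e0]; last first.
    by apply: filterS (cont_on_lim J0_cont UF Fy Fu Py Pu yl ul e0) => z /Rabs_def2 /=; lra.
  apply/in_B_iff; split=> //; split=> // i x Px; apply: le_epsilon => e e0.
  have e2 : 0 < e / 2 by lra.
  have Fx : F (fun=> P i x) by apply: filterS filterT.
  have h1 := payoff_upd_lim security_continuous UF Fu Pu ul Fx Px (ultralim_const d_refl x UF) e2.
  have h2 := cont_on_lim (J_cont i) UF Fy Fu Py Pu yl ul e2.
  have [z [[/Rabs_def2 h1z /Rabs_def2 h2z] /in_B_iff[_ [_ /(_ i x Px)]]]] :=
    filter_ex (filterI (filterI h1 h2) FB).
  by rewrite /=; lra.
- by exists y, u; split=> // y' u' hB'; apply: (opt (y', u')).
Qed.

End Leader.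

Theorem theorem2 :
  (* parts (1) and (2): general compact metric strategy spaces *)
  (forall (n : nat) (X0 : Type) (d0 : X0 -> X0 -> R)
          (X : I n -> Type) (d : forall i, X i -> X i -> R)
          (P0 : X0 -> Prop) (P : forall i, X i -> Prop)
          (J0 : X0 -> (forall i, X i) -> R)
          (J : I n -> X0 -> (forall i, X i) -> R),
     is_metric d0 -> (forall i, is_metric (d i)) ->
     game_hyps n X0 d0 X d P0 P J0 J ->
     (forall (alpha' : (forall i, X i) -> X0) (u' : forall i, X i),
        incentive n X0 X P0 P alpha' ->
        inv_stackelberg n X0 X P0 P J0 J alpha' u' ->
        max_on_B n X0 X P0 P J0 J (alpha' u') u')
     /\
     (forall (x0' : X0) (u' : forall i, X i),
        max_on_B n X0 X P0 P J0 J x0' u' ->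
        exists alpha' : (forall i, X i) -> X0,
          incentive n X0 X P0 P alpha' /\ alpha' u' = x0' /\
          inv_stackelberg n X0 X P0 P J0 J alpha' u'))
  /\
  (* part (3): followers' strategy sets are convex compact subsets of Euclidean spaces *)
  (forall (n : nat) (X0 : Type) (d0 : X0 -> X0 -> R) (m : I n -> nat)
          (P0 : X0 -> Prop) (P : forall i, Rn (m i) -> Prop)
          (J0 : X0 -> (forall i, Rn (m i)) -> R)
          (J : I n -> X0 -> (forall i, Rn (m i)) -> R),
     is_metric d0 ->
     game_hyps n X0 d0 (fun i => Rn (m i)) (fun i => euclid (m i)) P0 P J0 J ->
     (forall i, convex (P i)) ->
     (forall i (x0 : X0) (u : forall j, Rn (m j)),
        P0 x0 -> inP n (fun j => Rn (m j)) P u ->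
        quasiconcave_on (P i)
          (fun x => J i x0 (@upd n (fun j => Rn (m j)) u i x))) ->
     exists (alpha' : (forall i, Rn (m i)) -> X0) (u' : forall i, Rn (m i)),
       incentive n X0 (fun i => Rn (m i)) P0 P alpha' /\
       inv_stackelberg n X0 (fun i => Rn (m i)) P0 P J0 J alpha' u').
Proof.
split.
  move=> n X0 d0 X d P0 P J0 J m0 m hyps.
  have d0_refl x : d0 x x = 0 by apply/(proj1 (proj2 m0)).
  have d_refl i x : d i x x = 0 by apply/(proj1 (proj2 (m i))).
  have d0_tri : forall x y z, d0 x z <= d0 x y + d0 y z by case: m0 => _ [_ []].
  have d_tri i : forall x y z, d i x z <= d i x y + d i y z by case: (m i) => _ [_ []].
  have [g hg] := security_ex d0_refl d0_tri d_refl hyps.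
  split=> [alpha u|y u].
    exact: (solution_max_on_B d0_refl d0_tri d_refl d_tri hyps hg).
  exact: (max_on_B_solution d0_refl d0_tri d_refl d_tri hyps hg).
move=> n X0 d0 m P0 P J0 J m0 hyps P_convex J_quasiconcave.
have d0_refl x : d0 x x = 0 by apply/(proj1 (proj2 m0)).
have d0_tri : forall x y z, d0 x z <= d0 x y + d0 y z by case: m0 => _ [_ []].
have d_refl i := @euclid_refl (m i); have d_tri i := @euclid_triangle (m i).
have [[y0 Py0] [_ [hP _]]] := hyps.
have [g hg] := security_ex d0_refl d0_tri d_refl hyps.
have g_cont := security_continuous d0_refl d0_tri hyps hg.
have g_quasiconcave i u : inP n _ P u ->
    quasiconcave_on (P i) (fun x => g i (upd (X := fun j => Rn (m j)) u i x)).
  move=> Pu x x' t Px Px' t01.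
  (* Fix a leader's strategy [y] attaining the minimum at the convex combination and use
     quasiconcavity of [J i y]; at the two end points [g] is at most the payoff under [y]. *)
  have [[y [Py <-]] _] := hg i _ (inP_upd Pu (P_convex i x x' t Px Px' t01)).
  apply: Rle_trans _ (J_quasiconcave i y u Py Pu x x' t Px Px' t01).
  have [_ /(_ y Py) h] := hg i _ (inP_upd Pu Px).
  have [_ /(_ y Py) h'] := hg i _ (inP_upd Pu Px').
  by apply: Rmin_glb; [apply: Rle_trans (Rmin_l _ _) h|apply: Rle_trans (Rmin_r _ _) h'].
have [u [Pu hu]] := nash_equilibrium (fun i => proj1 (hP i)) (fun i => proj2 (hP i))
  P_convex g_cont g_quasiconcave.
have [|y [v hmax]] := max_on_B_ex d0_refl d0_tri d_refl d_tri hyps hg.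
  exists y0, u; apply/(in_B_iff d0_refl d0_tri d_refl d_tri hyps hg).
  split=> //; split=> // i x Px; apply: Rle_trans (hu i x Px) _.
  by have [_] := hg i u Pu; apply.
have [alpha [Pa [_ sol]]] := max_on_B_solution d0_refl d0_tri d_refl d_tri hyps hg hmax.
by exists alpha, v.
Qed.
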